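(* For every integer $n\ge 3$, let $C_n$ be the cycle graph on $n$ vertices. Then $$X_{C_n}^2=X_{C_n}-2n\,M_{11\cdots1},$$ where $11\cdots1$ denotes the composition of $n$ with $n$ parts all equal to $1$.
   Context: $\mathbb{P}$ denotes the positive integers. An orientation of a simple graph $G$ is a directed graph on the same vertices containing, for each edge $\{i,j\}$ of $G$, exactly one of $(i,j)$, $(j,i)$ (and no other edges). For $k\ge1$, an orientation $\mathcal{O}$ of $G$ is $k$-balanced if for every cycle of $G$ with edges $\{v_1,v_2\},\{v_2,v_3\},\dots,\{v_{r-1},v_r\},\{v_r,v_1\}$, $\mathcal{O}$ contains at least $k$ directed edges of the form $(v_i,v_{i+1})$ and at least $k$ directed edges of the form $(v_{i+1},v_i)$ (subscripts modulo $r$). A proper coloring of $G$ is a map $\kappa:V(G)\to\mathbb{P}$ with $\kappa(i)\ne\kappa(j)$ whenever $\{i,j\}$ is an edge. The orientation $\mathcal{O}_\kappa$ induced by a proper coloring $\kappa$ directs each edge toward the endpoint with the greater color; $\kappa$ is a $k$-balanced coloring if $\mathcal{O}_\kappa$ is $k$-balanced. For a finite simple graph $G$ with $V(G)=[n]$, the $k$-balanced chromatic quasisymmetric function of $G$ is $$X_G^k=\sum_{\kappa}x_{\kappa(1)}x_{\kappa(2)}\cdots x_{\kappa(n)},$$ summed over all $k$-balanced colorings $\kappa:V(G)\to\mathbb{P}$, and Stanley's chromatic symmetric function is $X_G=\sum_\kappa x_{\kappa(1)}\cdots x_{\kappa(n)}$, summed over all proper colorings $\kappa:V(G)\to\mathbb{P}$;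 here $x_1,x_2,\dots$ are commuting indeterminates. For a composition $\alpha=(\alpha_1,\dots,\alpha_\ell)$ (ordered list of positive integers), the monomial quasisymmetric function is $M_\alpha=\sum_{i_1<i_2<\cdots<i_\ell}x_{i_1}^{\alpha_1}x_{i_2}^{\alpha_2}\cdots x_{i_\ell}^{\alpha_\ell}$. *)

(* Defs.v *)
From HB Require Import structures.
From mathcomp Require Import all_boot all_order all_algebra finmap.
From mathcomp Require Import boolp classical_sets functions cardinality fsbigop.
From mathcomp.multinomials Require Export monalg.

Set Implicit Arguments.
Unset Strict Implicit.
Unset Printing Implicit Defensive.

Import GRing.Theory.

Local Open Scope classical_set_scope.
Local Open Scope ring_scope.

Definition posnat : Type := {n : nat | (0 < n)%N}.

Definition posnat1 : posnat := exist (fun n => (0 < n)%N) 1%N isT.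

(* A monomial is an element of the free commutative monoid over [posnat], and
   a power series is its coefficient function; addition and subtraction are
   the pointwise ones. *)
Notation fpseries := ({cmonom posnat} -> int).

(* The formal infinite sum of the monomials [mon i], [i \in A]: the coefficient
   of m is the number of i in A with [mon i = m].  The operator [\sum_(_ \in _)]
   is only meaningful if this number is finite for each m; [finite_colorings]
   and [finite_increasing] below show that it is for the sums used here. *)
Definition sum_monom (I : choiceType) (A : set I)
    (mon : I -> {cmonom posnat}) : fpseries :=
  fun m => \sum_(i \in A) ((mon i == m)%:R : int).

Record sgraph (T : finType) := SGraph {
  adj :> rel T;
  adj_sym : symmetric adj;
  adj_irrefl : irreflexive adj
}.

Definition is_orientation (T : finType) (G : sgraph T) (o : rel T) : Prop :=
  (forall x y, o x y -> G x y) /\ (forall x y, G x y -> o x y (+) o y x).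

(* A cycle is given by its sequence of pairwise distinct vertices, of length at
   least 3; [next c x] is the vertex following x in c, cyclically.  Distinct
   positions in c yield distinct edges, so [count] counts directed edges. *)
Definition balanced (k : nat) (T : finType) (G : sgraph T) (o : rel T) : Prop :=
  forall c : seq T, (2 < size c)%N -> ucycle G c ->
    (k <= count (fun x => o x (next c x)) c)%N /\
    (k <= count (fun x => o (next c x) x) c)%N.

Definition proper_coloring (T : finType) (G : sgraph T)
    (kappa : {ffun T -> posnat}) : Prop :=
  forall x y, G x y -> kappa x <> kappa y.

Definition induced_orientation (T : finType) (G : sgraph T)
    (kappa : {ffun T -> posnat}) : rel T :=
  [rel x y | G x y && (val (kappa x) < val (kappa y))%N].

Lemma induced_orientationP (T : finType) (G : sgraph T)
    (kappa : {ffun T -> posnat}) :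
  proper_coloring G kappa -> is_orientation G (induced_orientation G kappa).
Proof.
move=> pk; split=> [x y /andP[]//|x y Gxy] /=.
have Gyx : G y x by rewrite adj_sym.
rewrite /induced_orientation /= Gxy Gyx /=; case: ltngtP => // /val_inj.
by move/(pk _ _ Gxy).
Qed.

Definition balanced_coloring (k : nat) (T : finType) (G : sgraph T)
    (kappa : {ffun T -> posnat}) : Prop :=
  proper_coloring G kappa /\ balanced k G (induced_orientation G kappa).

Definition coloring_monom (T : finType) (kappa : {ffun T -> posnat}) :
    {cmonom posnat} :=
  \big[mmul/mone]_(v : T) ucm (kappa v).

Definition chromatic_sym (T : finType) (G : sgraph T) : fpseries :=
  sum_monom [set kappa | proper_coloring G kappa] (@coloring_monom T).

Definition balanced_chromatic_qsym (k : nat) (T : finType) (G : sgraph T) :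
    fpseries :=
  sum_monom [set kappa | balanced_coloring k G kappa] (@coloring_monom T).

Definition composition := seq posnat.

Definition increasing (l : nat) (i : {ffun 'I_l -> posnat}) : Prop :=
  forall a b : 'I_l, (a < b)%N -> (val (i a) < val (i b))%N.

Definition power_monom (alpha : composition)
    (i : {ffun 'I_(size alpha) -> posnat}) : {cmonom posnat} :=
  \big[mmul/mone]_(j < size alpha)
    expcmn (ucm (i j)) (val (tnth (in_tuple alpha) j)).

Definition monomial_qsym (alpha : composition) : fpseries :=
  sum_monom [set i | increasing i] (@power_monom alpha).

Definition all_ones (n : nat) : composition := nseq n posnat1.

Lemma finite_prod_monom (T : finType) (mon : T -> posnat -> {cmonom posnat})
    (m : {cmonom posnat}) :
  (forall v i, i \in finsupp (mon v i)) ->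
  finite_set [set f : {ffun T -> posnat} |
                \big[mmul/mone]_(v : T) mon v (f v) = m].
Proof.
move=> monP; pose D := finsupp m.
pose h (g : {ffun T -> option D}) : {ffun T -> posnat} :=
  [ffun v => if g v is Some d then fsval d else posnat1].
apply: (@sub_finite_set _ _ (range h)); last exact: finite_image.
move=> f /= fm.
have fD v : f v \in D.
  rewrite /D -fm (bigD1 v) //= mem_finsupp cmM addn_eq0 negb_and.
  by rewrite -mem_finsupp monP.
by exists [ffun v => Some [` fD v]%fset] => //; apply/ffunP => v; rewrite !ffunE.
Qed.

Lemma finite_colorings (T : finType) (m : {cmonom posnat}) :
  finite_set [set kappa : {ffun T -> posnat} | coloring_monom kappa = m].
Proof.
apply: finite_prod_monom (fun _ i => ucm i) m _ => _ i.
by rewrite mem_finsupp cmU eqxx.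
Qed.

Lemma finite_increasing (alpha : composition) (m : {cmonom posnat}) :
  finite_set [set i : {ffun 'I_(size alpha) -> posnat} | power_monom i = m].
Proof.
apply: finite_prod_monom
  (fun j i => expcmn (ucm i) (val (tnth (in_tuple alpha) j))) m _ => j i.
rewrite mem_finsupp.
suff -> : forall e, expcmn (ucm i) e i = e.
  by rewrite -lt0n; exact: valP.
case=> [|e]; first exact: onecmE.
rewrite /expcmn iteropS.
by elim: e => [|e IHe] /=; rewrite ?mulcmE ucmE eqxx ?IHe.
Qed.

(* [ordS] is the cyclic successor i |-> i + 1 mod n; the disequality only
   matters for n = 1. *)
Definition cycle_rel (n : nat) : rel 'I_n :=
  [rel i j | (i != j) && ((j == ordS i) || (i == ordS j))].

Lemma cycle_rel_sym n : symmetric (@cycle_rel n).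
Proof. by move=> i j; rewrite /cycle_rel /= eq_sym orbC. Qed.

Lemma cycle_rel_irrefl n : irreflexive (@cycle_rel n).
Proof. by move=> i; rewrite /cycle_rel /= eqxx. Qed.

Definition cycle_graph (n : nat) : sgraph 'I_n :=
  SGraph (@cycle_rel_sym n) (@cycle_rel_irrefl n).

(* Main.v *)
(* A proper coloring of the n-cycle fails to be 2-balanced exactly when, going
   around the cycle, it has a single descent or a single ascent (it has at
   least one of each, and they are n >= 3 in total, so not both).  Cutting the
   cycle at that edge, at position r, such a coloring is the composite of an
   increasing map with one of 2n bijections ([cyc_rank b r]), so each choice of
   r and of the direction b contributes one copy of M_{1...1}. *)

Require Import Defs.
From mathcomp Require Import all_boot all_order all_algebra.
From mathcomp Require Import finmap zify.
From mathcomp Require Import boolp classical_sets functions cardinality fsbigop.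

Set Implicit Arguments.
Unset Strict Implicit.
Unset Printing Implicit Defensive.

Import GRing.Theory.

Local Open Scope ring_scope.

(** * Coefficients of formal sums *)

(** The range of summation depends on [m] but not on [A], so coefficients of sums over different
    sets can be compared indicator by indicator. *)
Lemma sum_monom_fset (I : choiceType) (A : set I) (mon : I -> {cmonom posnat})
    (m : {cmonom posnat}) :
  finite_set [set i | mon i = m]%classic ->
  sum_monom A mon m =
    \sum_(i <- fset_set [set i | mon i = m]%classic) (`[< A i >])%:R.
Proof.
move=> finm; rewrite -fsbig_finite // /sum_monom.
rewrite [LHS]fsbig_mkcond [RHS]fsbig_mkcond; apply: eq_fsbigr => i _.
rewrite /patch; have -> : (i \in A) = `[< A i >] by rewrite unfold_in.
have -> : (i \in [set i | mon i = m]%classic) = (mon i == m).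
  by apply/idP/eqP; rewrite inE.
by case: `[< A i >]; case: (mon i == m).
Qed.

(** * Arithmetic on the vertices modulo [m.+2] *)

Lemma ordSE m (x : 'I_m.+2) : ordS x = x + 1.
Proof. by apply: val_inj; rewrite /= modnDmr addn1. Qed.

Lemma val_ordN1 m : val (-1 : 'I_m.+2) = m.+1.
Proof. by rewrite /= !modn_small ?subn1. Qed.

Lemma val_ordD1 m (x : 'I_m.+2) : x != -1 -> val (x + 1) = x.+1.
Proof.
move=> xN; rewrite -ordSE /= modn_small // ltn_neqAle ltn_ord andbT.
by apply: contra_neq xN => -[xm]; apply: val_inj; rewrite val_ordN1.
Qed.

(** Induction on the distance [y - x], peeling off the last step. The step at [-1] is excluded
    because [x + 1] wraps around to 0 there. *)
Lemma ord_step_trans m (T : Type) (R : rel T) (f : 'I_m.+2 -> T) :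
  transitive R -> (forall x, x != -1 -> R (f x) (f (x + 1))) ->
  forall x y : 'I_m.+2, (x < y)%N -> R (f x) (f y).
Proof.
move=> Rt step x y; have [k] := ubnP (y - x)%N.
elim: k y => // k IH y yxk xy.
have y0 : (0 < y)%N by lia.
have yN : y - 1 != -1.
  by rewrite -subr_eq0 opprK subrK; apply: contraTneq y0 => ->.
have vy : val y = (val (y - 1)).+1 by rewrite -(val_ordD1 yN) subrK.
have := step _ yN; rewrite subrK => Ry.
have [/val_inj -> // | /eqP ne] := eqVneq (val x) (val (y - 1)).
(* A fresh name keeps [/=] and [lia] away from the modular subtraction. *)
have {yN} [z Ez] : exists z, z = y - 1 by exists (y - 1).
rewrite -Ez /= in vy ne Ry.
by apply: Rt Ry; apply: IH; lia.
Qed.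

(** * Colorings monotone along the cycle cut at one edge *)

Definition dir_lt (b : bool) : rel nat := if b then gtn else ltn.

Lemma dir_lt_trans b : transitive (dir_lt b).
Proof.
by case: b => y x z /= xy yz; [apply: ltn_trans yz xy | apply: ltn_trans xy yz].
Qed.

Lemma dir_lt_irr b x : dir_lt b x x = false.
Proof. by case: b; apply: ltnn. Qed.

(* The position of [x] when [r + 1, r + 2, ..., r] is listed in this order
   ([b = false]) or in the reverse one ([b = true]). *)
Definition cyc_rank m (b : bool) (r x : 'I_m.+2) : 'I_m.+2 :=
  if b then rev_ord (x - (r + 1)) else x - (r + 1).

Lemma cyc_rank_inj m b (r : 'I_m.+2) : injective (cyc_rank b r).
Proof. by case: b => x y; [move/rev_ord_inj|]; apply: addIr. Qed.

Lemma cyc_rank_lt m b (r x y : 'I_m.+2) :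
  (cyc_rank b r x < cyc_rank b r y)%N =
  dir_lt b (x - (r + 1))%R (y - (r + 1))%R.
Proof.
case: b; last by []; rewrite /cyc_rank; move: (x - _) (y - _) => u v.
by have := ltn_ord u; have := ltn_ord v; rewrite /dir_lt /=; lia.
Qed.

Definition compatible n (rk : 'I_n -> 'I_n) (kappa : {ffun 'I_n -> posnat}) :=
  forall x y, (rk x < rk y)%N -> (val (kappa x) < val (kappa y))%N.

(** Translation by [r + 1] carries the list 0, 1, ..., -1 to r + 1, r + 2, ..., r. The excluded wrap
    at -1 thus becomes the edge from r to r + 1, and transitivity reduces compatibility to the other
    edges. *)
Lemma compatible_cyc_rank m b r (kappa : {ffun 'I_m.+2 -> posnat}) :
  compatible (cyc_rank b r) kappa <->
  forall x, x != r -> dir_lt b (val (kappa x)) (val (kappa (x + 1))).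
Proof.
have ltE x y : ((x - (r + 1))%R < (y - (r + 1))%R)%N ->
    compatible (cyc_rank b r) kappa -> dir_lt b (val (kappa x)) (val (kappa y)).
  by case: b => xy comp /=; [apply: (comp y x)|apply: (comp x y)];
    rewrite cyc_rank_lt; apply: xy.
split=> [comp x xr|step x y].
  apply: ltE comp; have -> : x + 1 - (r + 1) = x - (r + 1) + 1.
    by rewrite addrAC.
  rewrite val_ordD1 //; apply: contra_neq xr => xr.
  by rewrite -[x](subrK (r + 1)) xr addrC addrK.
have lt' : forall u v : 'I_m.+2, (u < v)%N ->
    dir_lt b (val (kappa (u + (r + 1)))) (val (kappa (v + (r + 1)))).
  apply: (@ord_step_trans m _ _ (fun u => val (kappa (u + (r + 1))))).
    exact: dir_lt_trans.
  move=> u uN; rewrite (addrAC u 1); apply: step.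
  by apply: contra_neq uN => e;
    rewrite -[u](addrK (r + 1)) e opprD addrA subrr add0r.
by rewrite cyc_rank_lt; case: b lt' {step ltE} => lt' xy;
  have := lt' _ _ xy; rewrite !subrK.
Qed.

(* For a proper coloring of the cycle, the descents if [b = false] and the
   ascents if [b = true]. *)
Definition weak_dir_steps m (b : bool) (kappa : {ffun 'I_m.+2 -> posnat}) :=
  [set x | ~~ dir_lt b (val (kappa x)) (val (kappa (x + 1)))].

(** Otherwise the strict steps from 0 to -1, closed up by the step from -1 to 0, would make a color
    strictly smaller or greater than itself. *)
Lemma weak_dir_steps_neq0 m b (kappa : {ffun 'I_m.+2 -> posnat}) :
  weak_dir_steps b kappa != finset.set0.
Proof.
apply/eqP => /finset.setP E.
have st x : dir_lt b (val (kappa x)) (val (kappa (x + 1))).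
  by have := E x; rewrite !inE => /negbFE.
have ot : (nat_of_ord (0 : 'I_m.+2)%R < nat_of_ord (-1 : 'I_m.+2)%R)%N.
  by rewrite val_ordN1.
have := @ord_step_trans m _ _ (fun u => val (kappa u)) (@dir_lt_trans b)
  (fun x _ => st x) _ _ ot.
have := st (-1); rewrite addNr => h1 h2.
by have := dir_lt_trans h1 h2; rewrite dir_lt_irr.
Qed.

(** Compatibility only says that no weak step occurs outside [r]; nonemptiness turns this inclusion
    into an equality. Hence [b] and [kappa] leave at most one choice of [r]. *)
Lemma compatible_weak_dir_steps m b r (kappa : {ffun 'I_m.+2 -> posnat}) :
  `[< compatible (cyc_rank b r) kappa >] = (weak_dir_steps b kappa == [set r]).
Proof.
apply/asboolP/eqP => [/compatible_cyc_rank st|E].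
  apply/eqP; have := weak_dir_steps_neq0 b kappa.
  have : weak_dir_steps b kappa \subset [set r].
    apply/fintype.subsetP => x; rewrite !inE; apply: contraR => xr; exact: st.
  by rewrite subset1 => /orP[//|/eqP->]; rewrite eqxx.
apply/compatible_cyc_rank => x xr.
by move/finset.setP/(_ x): E; rewrite !inE (negbTE xr) => /negbFE.
Qed.

Lemma sum_compatible_cyc_rank m b (kappa : {ffun 'I_m.+2 -> posnat}) :
  \sum_r (`[< compatible (cyc_rank b r) kappa >])%:R =
  (#|weak_dir_steps b kappa| == 1%N)%:R :> int.
Proof.
under eq_bigr => r _ do rewrite compatible_weak_dir_steps.
case: cards1P => [[r0 ->]|no].
  rewrite (bigD1 r0) //= eqxx big1 ?addr0 // => r rr0.
  by rewrite (inj_eq finset.set1_inj) eq_sym (negbTE rr0).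
by apply: big1 => r _; case: eqP => // E; case: no; exists r.
Qed.

(** * Compatible colorings and the all-ones monomial function *)

Lemma power_monom_all_ones n (i : {ffun 'I_(size (all_ones n)) -> posnat}) :
  power_monom i = \big[mmul/mone]_j ucm (i j).
Proof.
apply: eq_bigr => j _.
by rewrite (tnth_nth posnat1) /= nth_nseq; case: ifP.
Qed.

(** An injective [rk] is a permutation, and precomposing with it maps increasing families
    bijectively to compatible colorings. It only permutes the factors of the monomial. *)
Lemma sum_monom_compatible n (rk : 'I_n -> 'I_n) : injective rk ->
  sum_monom [set kappa | compatible rk kappa]%classic (@coloring_monom 'I_n) =
  monomial_qsym (all_ones n).
Proof.
move=> rk_inj; apply/funext => m; rewrite /monomial_qsym /sum_monom.
have szn : n = size (all_ones n) by rewrite size_nseq.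
pose s x := cast_ord szn (rk x).
have [g gK Kg] : bijective s.
  apply: inj_card_bij; last by rewrite !card_ord -szn.
  by apply: inj_comp rk_inj; apply: cast_ord_inj.
pose h (i : {ffun 'I_(size (all_ones n)) -> posnat}) := [ffun x => i (s x)].
rewrite (reindex_fsbig h [set i | increasing i]%classic); last first.
  split=> [i /= inc x y xy|i j _ _ /ffunP E|kappa /= comp].
  - by rewrite !ffunE; apply: inc.
  - by apply/ffunP => a; have := E (g a); rewrite !ffunE Kg.
  exists [ffun a => kappa (g a)]; last by apply/ffunP => x; rewrite !ffunE gK.
  move=> a b ab /=; rewrite !ffunE; apply: comp.
  by rewrite -[a]Kg -[b]Kg in ab.
apply: eq_fsbigr => i _; congr (_ == m)%:R.
rewrite power_monom_all_ones (reindex s); last by exists g => x _.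
by apply: eq_bigr => x _; rewrite ffunE.
Qed.

(** * Cycles of the cycle graph *)

(** Rules out backtracking: after rotating [x] to the front, its second successor is the third
    entry. *)
Lemma next_next_neq (T : eqType) (c : seq T) x :
  uniq c -> (2 < size c)%N -> x \in c -> next c (next c x) != x.
Proof.
move=> Uc sz xc; have [i c' E] := rot_to xc.
rewrite -!(next_rot i Uc) E.
have : uniq (x :: c') by rewrite -E rot_uniq.
have : (2 < size (x :: c'))%N by rewrite -E size_rot.
case: c' {E} => [|y [|z c']] //= _; rewrite !inE !negb_or.
case/andP=> /and3P[xy xz _] _.
by rewrite eqxx [y == x]eq_sym (negbTE xy) eqxx eq_sym.
Qed.

Lemma cycle_graphP m (x y : 'I_m.+2) :
  reflect (y = x + 1 \/ y = x - 1) (cycle_graph m.+2 x y).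
Proof.
have -> : cycle_graph m.+2 x y = (x != y) && ((y == x + 1) || (x == y + 1)).
  by rewrite -!ordSE.
have one0 : (1 : 'I_m.+2) != 0 by apply: oner_neq0.
have -> : (x == y + 1) = (y == x - 1) by rewrite eq_sym -subr_eq opprK.
apply: (iffP andP) => [[_ /orP[/eqP|/eqP]]|]; [by left|by right|].
by case=> ->; rewrite eqxx ?orbT; split=> //;
  rewrite eq_sym -subr_eq0 addrAC subrr add0r ?oppr_eq0.
Qed.

(** Each step is +1 or -1, and a change of sign would be a backtrack. The walk therefore keeps its
    sense and, as 1 and -1 both generate the cyclic group, meets every vertex. *)
Lemma cycle_graph_next m (c : seq 'I_m.+2) :
  (2 < size c)%N -> ucycle (cycle_graph m.+2) c ->
  exists2 s : 'I_m.+2, s = 1 \/ s = -1 &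
    forall x, x \in c /\ next c x = x + s.
Proof.
move=> sz /andP[cyc Uc].
have [x0 x0c] : exists x0, x0 \in c.
  by case: c sz {cyc Uc} => // x c _; exists x; rewrite mem_head.
have nxt x (xc : x \in c) := cycle_graphP _ _ (next_cycle cyc xc).
have [s spm ns] : exists2 s : 'I_m.+2, s = 1 \/ s = -1 & next c x0 = x0 + s.
  by case: (nxt _ x0c) => ?; [exists 1|exists (-1)]; auto.
have step x : x \in c -> next c x = x + s ->
    x + s \in c /\ next c (x + s) = x + s + s.
  move=> xc nx; have xsc : x + s \in c by rewrite -nx mem_next.
  split=> //; have := next_next_neq Uc sz xc; rewrite nx.
  case: spm (nxt _ xsc) => -> [] -> //; by rewrite ?addrK ?subrK eqxx.
have all_k k : x0 + s *+ k \in c /\ next c (x0 + s *+ k) = x0 + s *+ k + s.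
  elim: k => [|k [kc kn]]; first by rewrite mulr0n addr0.
  by rewrite mulrSr addrA; apply: step.
exists s => // x; suff [k ->] : exists k, x = x0 + s *+ k by [].
case: spm => ->.
  (* The number of steps is the residue [x - x0] (below, [x0 - x]) read as a natural number. *)
  by exists (x - x0 : 'I_m.+2); rewrite natr_Zp addrC subrK.
by exists (x0 - x : 'I_m.+2); rewrite mulNrn natr_Zp opprB addrC subrK.
Qed.

Lemma count_all_card (T : finType) (c : seq T) (P : pred T) :
  uniq c -> (forall x, x \in c) -> count P c = #|[set x | P x]|.
Proof.
move=> Uc cT; have /permP-> : perm_eq c (enum T).
  by apply: uniq_perm => //; [apply: enum_uniq | move=> x; rewrite cT mem_enum].
rewrite cardsE cardE -size_filter /enum_mem -filter_predI; congr size.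
by apply: eq_filter => x; rewrite /= andbT.
Qed.

(** Up to rotation and reversal there is one cycle, the orbit of 0 under +1; reversal swaps the two
    counts. *)
Lemma balanced_cycle_graph k m (o : rel 'I_m.+3) :
  balanced k (cycle_graph m.+3) o <->
  (k <= #|[set x | o x (x + 1)%R]|)%N /\ (k <= #|[set x | o (x + 1)%R x]|)%N.
Proof.
split=> [bal|[up dn] c sz Uc].
  have fI : injective (fun x : 'I_m.+3 => x + 1) by move=> x y; apply: addIr.
  pose c := orbit (fun x : 'I_m.+3 => x + 1) 0.
  have cT x : x \in c.
    have iterE k' : iter k' (fun y : 'I_m.+3 => y + 1) 0 = k'%:R.
      by elim: k' => //= k' ->; rewrite mulrSr.
    by rewrite /c -fconnect_orbit -(natr_Zp x) -iterE fconnect_iter.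
  have Uc : uniq c by apply: orbit_uniq.
  have fc : fcycle (fun x : 'I_m.+3 => x + 1) c by apply: cycle_orbit.
  have nx x : next c x = x + 1 by rewrite -(eqP (next_cycle fc (cT x))).
  have sz : size c = m.+3.
    by rewrite -(card_uniqP Uc) -[RHS]card_ord; apply: eq_card => x; rewrite cT.
  have uc : ucycle (cycle_graph m.+3) c.
    apply/andP; split=> //; apply: sub_cycle fc => x y /= /eqP <-.
    by apply/cycle_graphP; left.
  have := bal c _ uc; rewrite sz => /(_ isT).
  by rewrite !count_all_card // (funext nx).
have [s spm cn] := cycle_graph_next sz Uc; have {Uc} [_ Uc] := andP Uc.
have cT x := (cn x).1; have nx x := (cn x).2.
rewrite !count_all_card // (funext nx).
case: spm => -> //.
(* Backward traversal indexes an edge by its other endpoint; a translation by 1 restores the forward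
   indexing. *)
have shift (P : rel 'I_m.+3) :
    #|[set x | P x (x - 1)]| = #|[set x | P (x + 1) x]|.
  rewrite -(card_preimset _ (addIr (1 : 'I_m.+3))); apply: eq_card => x.
  by rewrite !inE addrK.
by rewrite (shift o) (shift (fun x y => o y x)).
Qed.

(** * Counting ascents and descents *)

(** Properness makes weak steps strict, so these sets are the descents and the ascents. Neither is
    empty, so having at least 2 elements means not having exactly 1. *)
Lemma balanced2_dir_steps m (kappa : {ffun 'I_m.+3 -> posnat}) :
  proper_coloring (cycle_graph m.+3) kappa ->
  balanced 2 (cycle_graph m.+3) (induced_orientation (cycle_graph m.+3) kappa)
  <-> #|weak_dir_steps false kappa| != 1%N /\
      #|weak_dir_steps true kappa| != 1%N.
Proof.
move=> pk; set o := induced_orientation _ _.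
have adj1 x : cycle_graph m.+3 x (x + 1) by apply/cycle_graphP; left.
have neq x : val (kappa x) != val (kappa (x + 1)).
  by apply/eqP => /val_inj; apply: pk.
have oE x y : cycle_graph m.+3 x y -> o x y = (val (kappa x) < val (kappa y))%N.
  by move=> Gxy; apply: andb_idl.
have upE : [set x | o x (x + 1)] = weak_dir_steps true kappa.
  apply/finset.setP => x; rewrite !inE oE // /dir_lt /= -leqNgt.
  by rewrite [RHS]leq_eqVlt (negbTE (neq x)).
have dnE : [set x | o (x + 1) x] = weak_dir_steps false kappa.
  apply/finset.setP => x; rewrite !inE oE 1?adj_sym // /dir_lt /= -leqNgt.
  by rewrite [RHS]leq_eqVlt eq_sym (negbTE (neq x)).
rewrite balanced_cycle_graph upE dnE.
have := weak_dir_steps_neq0 true kappa; have := weak_dir_steps_neq0 false kappa.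
rewrite -!card_gt0; move: #|_| #|_| => a b; lia.
Qed.

Lemma card_weak_dir_steps m (kappa : {ffun 'I_m.+3 -> posnat}) :
  proper_coloring (cycle_graph m.+3) kappa ->
  (#|weak_dir_steps false kappa| + #|weak_dir_steps true kappa| = m.+3)%N.
Proof.
move=> pk; rewrite -[RHS]card_ord addnC.
rewrite -(cardC (mem (weak_dir_steps true kappa))).
congr addn; apply: eq_card => x; rewrite !inE /dir_lt /= -leqNgt.
rewrite negbK leq_eqVlt.
suff /negbTE -> : val (kappa (x + 1)) != val (kappa x) by [].
apply/eqP => /val_inj /esym; apply: pk; apply/cycle_graphP; by left.
Qed.

Lemma compatible_proper n rk (kappa : {ffun 'I_n -> posnat}) :
  injective rk -> compatible rk kappa -> proper_coloring (cycle_graph n) kappa.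
Proof.
move=> rk_inj comp x y Gxy E.
have : rk x != rk y by rewrite (inj_eq rk_inj); case/andP: Gxy.
by rewrite -val_eqE /= neq_ltn => /orP[] /comp; rewrite E ltnn.
Qed.

(** The theorem for a single coloring. Both sides vanish on improper colorings, since compatible
    ones are proper. *)
Lemma unbalanced_colorings m (kappa : {ffun 'I_m.+3 -> posnat}) :
  (`[< proper_coloring (cycle_graph m.+3) kappa >])%:R -
    (`[< balanced_coloring 2 (cycle_graph m.+3) kappa >])%:R =
  \sum_b \sum_r (`[< compatible (cyc_rank b r) kappa >])%:R :> int.
Proof.
have [pk|npk] := asboolP (proper_coloring (cycle_graph m.+3) kappa); last first.
  rewrite asboolF; last by case.
  rewrite big1 ?subrr // => b _; rewrite big1 // => r _.
  by rewrite asboolF // => /(compatible_proper (@cyc_rank_inj _ b r)).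
under eq_bigr => b _ do rewrite sum_compatible_cyc_rank.
rewrite big_bool /=; have := card_weak_dir_steps pk.
case: asboolP => [[_ /(balanced2_dir_steps pk)[/negbTE-> /negbTE->]] //|nbal].
move=> sm; case: eqP => [ut|/eqP ut]; case: eqP => [df|/eqP df] //.
  (* One ascent and one descent would total 2, not [m.+3]. *)
  by rewrite ut df in sm.
by case: nbal; split=> //; apply/balanced2_dir_steps.
Qed.

Theorem proposition4p1 (n : nat) (hn : (3 <= n)%N) :
  balanced_chromatic_qsym 2 (cycle_graph n) =
  chromatic_sym (cycle_graph n) - monomial_qsym (all_ones n) *+ (2 * n).
Proof.
case: n hn => [|[|[|m]]] // _.
have -> : monomial_qsym (all_ones m.+3) *+ (2 * m.+3) =
    \sum_b \sum_(r < m.+3) sum_monom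
      [set kappa | compatible (cyc_rank b r) kappa]%classic (@coloring_monom _).
  under eq_bigr => b _.
    under eq_bigr => r _ do rewrite (sum_monom_compatible (@cyc_rank_inj _ b r)).
    rewrite sumr_const card_ord; over.
  by rewrite sumr_const card_bool -mulrnA mulnC.
(* The difference of the two chromatic functions is isolated on one side, then compared with the
   double sum at the coefficient of [mon], coloring by coloring. *)
apply/eqP; rewrite eq_sym subr_eq addrC -subr_eq; apply/eqP/funext => mon.
rewrite /GRing.add /GRing.opp /= fct_sumE.
under [RHS]eq_bigr => b _ do rewrite fct_sumE.
have fin := @finite_colorings 'I_m.+3 mon.
rewrite /chromatic_sym /balanced_chromatic_qsym !(sum_monom_fset _ fin).
under [RHS]eq_bigr => b _.
  under eq_bigr => r _ do rewrite (sum_monom_fset _ fin).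
  rewrite exchange_big; over.
rewrite exchange_big -sumrB /=; apply: eq_bigr => kappa _.
exact: unbalanced_colorings.
Qed.
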